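(* Let $\mathbb{F}=\mathbb{Q}$. Let $$R = a\,L({\ast}{\ast}{\ast}) + b\,L({\ast}){\ast}{\ast} + c\,{\ast}L({\ast}){\ast} + d\,{\ast}{\ast}L({\ast})$$ be a nonzero operator polynomial of degree $3$ and multiplicity $1$ for a ternary associative operation, with coefficient vector $v=(a,b,c,d)\in\mathbb{F}^4$. Assume that (i) the components of $v$ belong to the set $\{0,\pm1,\pm2\}$, and (ii) $v$ produces submaximal rank in the matrix of consequences, i.e. the rank of the matrix of consequences of $R$ is strictly smaller than the rank, over the function field $\mathbb{F}(a,b,c,d)$, of the matrix of consequences of the generic operator polynomial with indeterminate coefficients $a,b,c,d$. Then the operator identity $R\equiv 0$ is equivalent to (that is, $R$ is a nonzero scalar multiple of the left-hand side of) one of the following identities, for some value in $\mathbb{F}$ of the parameter ($b$, $c$ or $d$) occurring in it: \begin{align*} &L({\ast}{\ast}{\ast}) + d\,{\ast}{\ast}L({\ast}) \equiv 0,\\ &L({\ast}{\ast}{\ast}) + b\,L({\ast}){\ast}{\ast} \equiv 0,\\ &L({\ast}{\ast}{\ast}) - L({\ast}){\ast}{\ast} + c\,{\ast}L({\ast}){\ast} - {\ast}{\ast}L({\ast}) \equiv 0,\\ &L({\ast}){\ast}{\ast} + d\,{\ast}{\ast}L({\ast}) \equiv 0,\\ &L({\ast}){\ast}{\ast} + c\,{\ast}L({\ast}){\ast} \equiv 0,\\ &{\ast}L({\ast}){\ast} + d\,{\ast}{\ast}L({\ast}) \equiv 0,\\ &{\ast}{\ast}L({\ast}) \equiv 0.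 \end{align*}
   Context: **Associative triple systems.** An associative triple system over $\mathbb{F}$ is a vector space $A$ with a trilinear product $p\colon A^3\to A$ satisfying $p(p(a_1,a_2,a_3),a_4,a_5)=p(a_1,p(a_2,a_3,a_4),a_5)=p(a_1,a_2,p(a_3,a_4,a_5))$. The product is written by juxtaposition, $p(x,y,z)=xyz$; by associativity the value of any product of an odd number of factors is independent of the placement of the operation symbols. $L$ denotes a linear operator on the underlying vector space (no relation between $L$ and $p$ is assumed). **Operator monomials.** (Ternary) operator monomials are defined recursively: a single indeterminate is an operator monomial; if $M_1,M_2,M_3$ are operator monomials then so is $p(M_1,M_2,M_3)=M_1M_2M_3$; if $M$ is an operator monomial then so is $L(M)$. Operator monomials are identified modulo ternary associativity of $p$. The degree is the number of indeterminates, and the multiplicity is the number of occurrences of $L$. In a monomial of degree $d$ the indeterminates are always $x_1,\dots,x_d$ in this order from left to right (nonsymmetric setting), so each indeterminate is written as the generic argument symbol $\ast$. The operator monomials of degree 3 and multiplicity 1 are $L({\ast}{\ast}{\ast})$, $L({\ast}){\ast}{\ast}$, ${\ast}L({\ast}){\ast}$, ${\ast}{\ast}L({\ast})$. There are 42 operator monomials of degree 5 and multiplicity 2. **Operator polynomials.** An operator polynomial $R$ (or operator identity $R\equiv0$) of degree $d$ and multiplicity $m$ is a nonzero linear combination over $\mathbb{F}$ of the operator monomials of degree $d$ and multiplicity $m$. Two operator polynomials are equivalent if they differ only by a nonzero scalar multiple. **Partial composition.** Operator monomials and polynomials of degree $k$ are regarded as operations of arity $k$ (so $p$ has arity 3 and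 $L$ has arity 1). If $\alpha,\beta$ have arities $k,n$ and $1\le i\le k$, then $\alpha\circ_i\beta$ is the operation of arity $k+n-1$ obtained by substituting $\beta$ for the $i$-th argument of $\alpha$: $$\alpha\circ_i\beta=\alpha(x_1,\dots,x_{i-1},\beta(x_i,\dots,x_{i+n-1}),x_{i+n},\dots,x_{k+n-1}).$$ It is extended bilinearly to linear combinations. When $\alpha$ has arity 1 we write $\alpha\circ\beta$. **Consequences.** Let $R$ be an operator polynomial of degree $3$ and multiplicity $m$. Its consequences are the following operator polynomials of degree $5$ and multiplicity $m+1$, for all admissible values of the indices: - $(R\circ_i p)\circ_j L$ ($1\le i\le3$, $1\le j\le5$); - $L\circ(R\circ_i p)$ ($1\le i\le 3$); - $(p\circ_i R)\circ_j L$ ($1\le i\le3$, $1\le j\le5$); - $L\circ(p\circ_i R)$ ($1\le i\le3$); - $(R\circ_i L)\circ_j p$ ($1\le i,j\le3$); - $p\circ_j(R\circ_i L)$ ($1\le i,j\le3$); - $(L\circ R)\circ_i p$ ($1\le i\le3$); - $p\circ_i(L\circ R)$ ($1\le i\le3$). **Matrix of consequences.** Let $S_1,\dots,S_k$ be the distinct consequences of $R$ (in any order) and let $m_1,\dots,m_\ell$ be all the operator monomials of degree $5$ and multiplicity $m+1$ (in a fixed total order; the choice of orders does not affect the rank). The matrix of consequences of $R$ is the $k\times\ell$ matrix whose $(i,j)$-entry is the coefficient of $m_j$ in $S_i$. For the generic $R$ of degree 3 and multiplicity 1, with indeterminate coefficients $a,b,c,d$, the matrix of consequences has size $42\times42$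 and its rank over $\mathbb{F}(a,b,c,d)$ is $36$, so submaximal rank means rank at most $35$. *)

(* Defs.v *)
(* MathComp *)
From HB Require Import structures.
From mathcomp Require Import all_boot all_order all_algebra.
From mathcomp Require Import freeg mpoly zify.

Set Implicit Arguments.
Unset Strict Implicit.
Unset Printing Implicit Defensive.

Import GRing.Theory.

Local Open Scope ring_scope.
Local Open Scope quotient_scope.

Inductive term : Type :=
  | Arg
  | Op of term & term & term
  | Lop of term.

Fixpoint term_enc (t : term) : GenTree.tree unit :=
  match t with
  | Arg => GenTree.Leaf tt
  | Op t1 t2 t3 => GenTree.Node 0 [:: term_enc t1; term_enc t2; term_enc t3]
  | Lop u => GenTree.Node 1 [:: term_enc u]
  end.

Fixpoint term_dec (g : GenTree.tree unit) : option term :=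
  match g with
  | GenTree.Leaf _ => Some Arg
  | GenTree.Node _ [:: g1; g2; g3] =>
      if (term_dec g1, term_dec g2, term_dec g3)
        is (Some t1, Some t2, Some t3) then Some (Op t1 t2 t3) else None
  | GenTree.Node _ [:: g1] => omap Lop (term_dec g1)
  | _ => None
  end.

Lemma term_encK : pcancel term_enc term_dec.
Proof. by elim=> [|t1 /= -> t2 -> t3 ->|t /= ->]. Qed.

HB.instance Definition _ := Countable.copy term (pcan_type term_encK).

Fixpoint tdeg (t : term) : nat :=
  match t with
  | Arg => 1
  | Op t1 t2 t3 => tdeg t1 + tdeg t2 + tdeg t3
  | Lop u => tdeg u
  end.

Fixpoint tmult (t : term) : nat :=
  match t with
  | Arg => 0
  | Op t1 t2 t3 => tmult t1 + tmult t2 + tmult t3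
  | Lop u => (tmult u).+1
  end.

(* The congruence generated by ternary associativity of [Op]. *)
Inductive assoc_eq : term -> term -> Prop :=
  | assoc_refl t : assoc_eq t t
  | assoc_sym t u : assoc_eq t u -> assoc_eq u t
  | assoc_trans t u v : assoc_eq t u -> assoc_eq u v -> assoc_eq t v
  | assoc_Op t1 t2 t3 u1 u2 u3 :
      assoc_eq t1 u1 -> assoc_eq t2 u2 -> assoc_eq t3 u3 ->
      assoc_eq (Op t1 t2 t3) (Op u1 u2 u3)
  | assoc_Lop t u : assoc_eq t u -> assoc_eq (Lop t) (Lop u)
  | assoc_lm t1 t2 t3 t4 t5 :
      assoc_eq (Op (Op t1 t2 t3) t4 t5) (Op t1 (Op t2 t3 t4) t5)
  | assoc_mr t1 t2 t3 t4 t5 :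
      assoc_eq (Op t1 (Op t2 t3 t4) t5) (Op t1 t2 (Op t3 t4 t5)).

(* [assoc_eq] is decided by comparing normal forms: a term is a product of an
   odd number of factors, each [Arg] or of the form [Lop _], and the normal
   form brackets these factors from the right. *)
Fixpoint comb (s : seq term) : term :=
  match s with
  | [:: t] => t
  | t1 :: t2 :: s' => Op t1 t2 (comb s')
  | [::] => Arg
  end.

Fixpoint factors (t : term) : seq term :=
  match t with
  | Arg => [:: Arg]
  | Op t1 t2 t3 => factors t1 ++ factors t2 ++ factors t3
  | Lop u => [:: Lop (comb (factors u))]
  end.

Definition nf (t : term) : term := comb (factors t).

Definition assoc_eqb (t u : term) : bool := nf t == nf u.

Lemma odd_size_factors t : odd (size (factors t)).
Proof.
elim: t => //= t1 h1 t2 h2 t3 h3.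
by rewrite !size_cat !oddD h1 h2 h3.
Qed.

Lemma odd_seq_ind (P : seq term -> Prop) :
  (forall x, P [:: x]) -> (forall x y s, odd (size s) -> P s -> P [:: x, y & s]) ->
  forall s, odd (size s) -> P s.
Proof.
move=> P1 P2 s; have [n] := ubnP (size s); elim: n s => // n IHn.
case=> [|x [|y s]] //= lt_n; rewrite negbK => os.
by apply: P2 => //; apply: IHn => //; rewrite ltnS in lt_n; apply: ltnW.
Qed.

Lemma comb_cons_cat x s2 s3 : odd (size s2) -> odd (size s3) ->
  assoc_eq (Op x (comb s2) (comb s3)) (comb (x :: s2 ++ s3)).
Proof.
move=> o2 o3; elim/odd_seq_ind: s2 / o2 x => [z|z w s2 o2 IH] x.
  by case: s3 o3 => // u s3 _; exact: assoc_refl.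
apply: assoc_trans (assoc_mr _ _ _ _ _) _.
by apply: assoc_Op (IH w); exact: assoc_refl.
Qed.

Lemma comb_cat s1 s2 s3 : odd (size s1) -> odd (size s2) -> odd (size s3) ->
  assoc_eq (Op (comb s1) (comb s2) (comb s3)) (comb (s1 ++ s2 ++ s3)).
Proof.
move=> o1 o2 o3; elim/odd_seq_ind: s1 / o1 => [x|x y s1 o1 IH].
  exact: comb_cons_cat.
apply: assoc_trans (assoc_lm _ _ _ _ _) _.
apply: assoc_trans (assoc_mr _ _ _ _ _) _.
by apply: assoc_Op IH; exact: assoc_refl.
Qed.

Lemma assoc_eq_nf t : assoc_eq t (nf t).
Proof.
elim: t => [|t1 h1 t2 h2 t3 h3|t h]; first exact: assoc_refl.
  apply: assoc_trans (assoc_Op h1 h2 h3) _.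
  by apply: comb_cat; exact: odd_size_factors.
exact: assoc_Lop.
Qed.

Lemma assoc_eq_factors t u : assoc_eq t u -> factors t = factors u.
Proof.
elim=> //= [t1 t2 t3 _ -> _ ->|? ? ? ? ? ? _ -> _ -> _ ->|? ? _ ->|*|*] //;
  by rewrite ?catA.
Qed.

Lemma assoc_eqP t u : reflect (assoc_eq t u) (assoc_eqb t u).
Proof.
apply: (iffP eqP) => [e|/assoc_eq_factors e]; last by rewrite /nf e.
by apply: assoc_trans (assoc_eq_nf t) _; rewrite e; exact/assoc_sym/assoc_eq_nf.
Qed.

Lemma assoc_eqb_refl : reflexive assoc_eqb.
Proof. by move=> t; apply: eqxx. Qed.

Lemma assoc_eqb_sym : ssrbool.symmetric assoc_eqb.
Proof. by move=> t u; apply: eq_sym. Qed.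

Lemma assoc_eqb_trans : transitive assoc_eqb.
Proof. by move=> u t v /eqP tu /eqP uv; rewrite /assoc_eqb tu uv. Qed.

Canonical assoc_equiv :=
  EquivRel assoc_eqb assoc_eqb_refl assoc_eqb_sym assoc_eqb_trans.

Definition opmon : Type := {eq_quot assoc_equiv}.
HB.instance Definition _ := Choice.on opmon.
HB.instance Definition _ := Quotient.on opmon.
HB.instance Definition _ := EqQuotient.on opmon.

Definition omon (t : term) : opmon := \pi_opmon t.

Lemma omonP t u : omon t = omon u <-> assoc_eq t u.
Proof.
by split=> [/eqmodP/assoc_eqP //|tu]; apply/eqmodP/assoc_eqP.
Qed.

(* Substitution of [u] for the [i]-th argument of [t], counted from 1. *)
Fixpoint tcomp (i : nat) (t u : term) : term :=
  match t with
  | Arg => if i == 1%N then u else Arg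
  | Op t1 t2 t3 =>
      if (i <= tdeg t1)%N then Op (tcomp i t1 u) t2 t3
      else if (i <= tdeg t1 + tdeg t2)%N then Op t1 (tcomp (i - tdeg t1) t2 u) t3
      else Op t1 t2 (tcomp (i - (tdeg t1 + tdeg t2)) t3 u)
  | Lop v => Lop (tcomp i v u)
  end.

Definition mcomp (i : nat) (x y : opmon) : opmon := omon (tcomp i (repr x) (repr y)).

Lemma assoc_eq_tdeg t u : assoc_eq t u -> tdeg t = tdeg u.
Proof.
elim=> //= [t1 t2 t3 _ -> _ ->|? ? ? ? ? ? _ -> _ -> _ ->|*|*] //;
  by rewrite ?addnA.
Qed.

Lemma assoc_eq_tmult t u : assoc_eq t u -> tmult t = tmult u.
Proof.
elim=> //= [t1 t2 t3 _ -> _ ->|? ? ? ? ? ? _ -> _ -> _ ->|? ? _ ->|*|*] //;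
  by rewrite ?addnA.
Qed.

Lemma tcomp_assocl i t t' u : assoc_eq t t' -> assoc_eq (tcomp i t u) (tcomp i t' u).
Proof.
move=> tt'; elim: tt' i => {t t'} /=.
- by move=> *; exact: assoc_refl.
- by move=> *; exact: assoc_sym.
- by move=> t v w _ h _ h' i; exact: assoc_trans (h i) (h' i).
- move=> t1 t2 t3 u1 u2 u3 e1 h1 e2 h2 e3 h3 i.
  rewrite (assoc_eq_tdeg e1) (assoc_eq_tdeg e2).
  by do 2?case: ifP => _; apply: assoc_Op.
- by move=> t v _ h i; exact: assoc_Lop.
- move=> t1 t2 t3 t4 t5 i; rewrite !subnDA !leq_subLR !addnA.
  by do !case: ifP => ?; first [lia | exact: assoc_lm].
- move=> t1 t2 t3 t4 t5 i; rewrite !subnDA !leq_subLR !addnA.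
  by do !case: ifP => ?; first [lia | exact: assoc_mr].
Qed.

Lemma tcomp_assocr i t u u' : assoc_eq u u' -> assoc_eq (tcomp i t u) (tcomp i t u').
Proof.
move=> uu'; elim: t i => [|t1 h1 t2 h2 t3 h3|t h] i /=.
- by case: ifP => // _; exact: assoc_refl.
- by do 2?case: ifP => _; apply: assoc_Op => //; exact: assoc_refl.
- exact: assoc_Lop.
Qed.

Lemma mcomp_omon i t u : mcomp i (omon t) (omon u) = omon (tcomp i t u).
Proof.
apply/omonP; apply: (assoc_trans (tcomp_assocl _ _ _) (tcomp_assocr _ _ _));
  by apply/assoc_eqP/eqmodP; rewrite reprK.
Qed.

Definition grow (d m : nat) (s : seq term) : seq term :=
  [seq t <- Arg :: [seq Lop t | t <- s]
            ++ [seq Op t12.1 t12.2 t3 | t12 <- [seq (t1, t2) | t1 <- s, t2 <- s],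
                                        t3 <- s]
     | (tdeg t <= d)%N && (tmult t <= m)%N].

(* [d + m] steps suffice: the height of a term is at most [tdeg t + tmult t]. *)
Definition terms (d m : nat) : seq term :=
  [seq t <- iter (d + m) (grow d m) [::] | (tdeg t == d) && (tmult t == m)].

Fixpoint theight (t : term) : nat :=
  match t with
  | Arg => 1
  | Op t1 t2 t3 => (maxn (theight t1) (maxn (theight t2) (theight t3))).+1
  | Lop u => (theight u).+1
  end.

Lemma tdeg_gt0 t : (0 < tdeg t)%N.
Proof. by elim: t => //= *; lia. Qed.

Lemma theight_le t : (theight t <= tdeg t + tmult t)%N.
Proof.
elim: t => //= [t1 h1 t2 h2 t3 h3|t h]; last by lia.
by have := (tdeg_gt0 t1, tdeg_gt0 t2, tdeg_gt0 t3) => -[[? ?] ?]; lia.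
Qed.

Lemma mem_iter_grow d m n t : (tdeg t <= d)%N -> (tmult t <= m)%N ->
  (theight t <= n)%N -> t \in iter n (grow d m) [::].
Proof.
elim: n t => [|n IHn] [|t1 t2 t3|t] //= ld lm lh; rewrite mem_filter /= ?ld ?lm /=.
- by rewrite inE eqxx.
- rewrite inE mem_cat; apply/orP; right; apply/orP; right.
  apply/allpairsP; exists ((t1, t2), t3); split=> //=; last by apply: IHn; lia.
  by apply/allpairsP; exists (t1, t2); split=> //=; apply: IHn; lia.
- rewrite inE mem_cat; apply/orP; right; apply/orP; left.
  by apply: map_f; apply: IHn; lia.
Qed.

Lemma mem_terms d m t : (t \in terms d m) = (tdeg t == d) && (tmult t == m).
Proof.
rewrite mem_filter andb_idr // => /andP[/eqP<- /eqP<-].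
by apply: mem_iter_grow; rewrite ?theight_le.
Qed.

(* All operator monomials of degree [d] and multiplicity [m], each listed once. *)
Definition monomials (d m : nat) : seq opmon := undup (map omon (terms d m)).

Lemma mem_monomials d m x :
  x \in monomials d m <-> exists t, [/\ x = omon t, tdeg t = d & tmult t = m].
Proof.
rewrite mem_undup; split=> [/mapP[t + ->]|[t [-> <- <-]]].
  by rewrite mem_terms => /andP[/eqP <- /eqP <-]; exists t.
by apply: map_f; rewrite mem_terms !eqxx.
Qed.

Definition oppoly (K : fieldType) : Type := {freeg opmon / K}.
HB.instance Definition _ (K : fieldType) := GRing.Lmodule.on (oppoly K).

Section Consequences.

Variable K : fieldType.

Definition monpoly (t : term) : oppoly K := << omon t >>.

Definition opcomp (i : nat) (P Q : oppoly K) : oppoly K :=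
  \sum_(x <- dom P) \sum_(y <- dom Q) (coeff x P * coeff y Q) *: << mcomp i x y >>.

Local Notation "P \o_ i Q" := (opcomp i P Q)
  (at level 50, i at level 2, left associativity).

Local Notation p := (monpoly (Op Arg Arg Arg)).
Local Notation L := (monpoly (Lop Arg)).

(* The consequences of [R] of degree 3, without repetition. *)
Definition consequences (R : oppoly K) : seq (oppoly K) :=
  undup (
       [seq (R \o_i p) \o_j L | i <- iota 1 3, j <- iota 1 5]
    ++ [seq L \o_1 (R \o_i p) | i <- iota 1 3]
    ++ [seq (p \o_i R) \o_j L | i <- iota 1 3, j <- iota 1 5]
    ++ [seq L \o_1 (p \o_i R) | i <- iota 1 3]
    ++ [seq (R \o_i L) \o_j p | i <- iota 1 3, j <- iota 1 3]
    ++ [seq p \o_j (R \o_i L) | i <- iota 1 3, j <- iota 1 3]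
    ++ [seq (L \o_1 R) \o_i p | i <- iota 1 3]
    ++ [seq p \o_i (L \o_1 R) | i <- iota 1 3]).

(* [m] is the multiplicity of [R]. *)
Definition conseq_matrix (m : nat) (R : oppoly K) :
    'M[K]_(size (consequences R), size (monomials 5 m.+1)) :=
  \matrix_(i, j) coeff (tnth (in_tuple (monomials 5 m.+1)) j)
                       (tnth (in_tuple (consequences R)) i).

(* The general operator polynomial of degree 3 and multiplicity 1. *)
Definition opR (a b c d : K) : oppoly K :=
    a *: monpoly (Lop (Op Arg Arg Arg)) + b *: monpoly (Op (Lop Arg) Arg Arg)
  + c *: monpoly (Op Arg (Lop Arg) Arg) + d *: monpoly (Op Arg Arg (Lop Arg)).

Definition equivalent (P Q : oppoly K) : Prop := exists2 k : K, k != 0 & P = k *: Q.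

End Consequences.

Definition ratfun4 (F : fieldType) : fieldType := {fraction {mpoly F[4]}}.

Definition indet (F : fieldType) (i : 'I_4) : ratfun4 F := tofrac ('X_i : {mpoly F[4]}).

Definition generic_opR (F : fieldType) : oppoly (ratfun4 F) :=
  opR (indet F 0) (indet F 1) (indet F 2) (indet F 3).

Definition submaximal_rank (F : fieldType) (R : oppoly F) : Prop :=
  (\rank (conseq_matrix 1 R) < \rank (conseq_matrix 1 (generic_opR F)))%N.

(* Main.v *)
Require Import Defs.
From HB Require Import structures.
From mathcomp Require Import all_boot all_order all_algebra.
From mathcomp Require Import freeg mpoly zify ring.

(** Write R for the operator polynomial, X_0, ..., X_4 for the monomials of
degree 5 and multiplicity 1 in which L is applied to a single argument, Y_0,
Y_1, Y_2 for those in which L is applied to three consecutive arguments, and Z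
for L applied to all five.  An occurrence of L in a monomial of degree 5 thus
covers a block of consecutive arguments, and a monomial of multiplicity 2
behaves like the product of its two blocks.

The consequences of R are then the products of a block with one of the six
polynomials R o_i p and p o_i R of degree 5 and multiplicity 1.  Two facts about
linear functionals follow, in which the rank is computed as the number of
monomials minus the dimension of the space of functionals that annihilate all
consequences.

If a function g on the nine blocks satisfies the six relations, then the
functional sending a monomial to the product of the values of g on its blocks
annihilates all consequences (weight_annihilates).  For generic coefficients the
values of g at X_0, X_1, X_2 can be prescribed, and suitable choices of them
give six independent functionals, so that the generic rank is at most the number
of monomials minus 6 (generic_rank_le).

Conversely, suppose that three of X_0, ..., X_4, Z determine all solutions of
the six relations.  A functional that annihilates the consequences induces a
symmetric array indexed by pairs of blocks, each row of which solves the
relations; if it vanishes at the six products of the three chosen blocks, the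
whole array is zero.  The three monomials in which L(L(xyz)) occurs lie outside
the array, but the functional vanishes at them too, since each is expressed by
the others in a consequence with coefficient a, b, c or d.  The rank is then at
least the number of monomials minus 6 (determines_rank), so it is not
submaximal.

The six relations are linear equations in nine unknowns.  If a is nonzero,
eliminating Y and Z leaves two linear forms in X_0, ..., X_4, and three of the
X_i determine everything unless these forms are dependent, which happens only
for (a, 0, 0, d), (a, b, 0, 0) and (a, -a, c, -a) (exists_determining).  If a = 0
and b, c, d are nonzero, then X_0, X_1, Z determine everything
(determines_first_last).  The remaining nonzero coefficient vectors are scalar
multiples of those in the seven families. *)

Set Implicit Arguments.
Unset Strict Implicit.
Unset Printing Implicit Defensive.

Import GRing.Theory.
Local Open Scope ring_scope.
Local Notation P3 := (Op Arg Arg Arg).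
Local Notation L1 := (Lop Arg).

(** * Consequences as linear combinations of four monomials *)

Lemma omon_nf t : omon (nf t) = omon t.
Proof. by apply/omonP/assoc_sym/assoc_eq_nf. Qed.

Lemma nf_omon t u : nf t = nf u -> omon t = omon u.
Proof. by move=> e; rewrite -omon_nf e omon_nf. Qed.

Definition quad := (term * term * term * term)%type.

Definition map4 (T U : Type) (f : T -> U) (q : T * T * T * T) : U * U * U * U :=
  let: (q0, q1, q2, q3) := q in (f q0, f q1, f q2, f q3).

Definition generators : quad := (Lop P3, Op L1 Arg Arg, Op Arg L1 Arg, Op Arg Arg L1).

(** A consequence arises by substituting R in a fixed composition of p and L,
so that its four monomials are obtained by applying one and the same map to the
four monomials of R. *)
Definition contexts : seq (term -> term) :=
     [seq fun t => tcomp j (tcomp i t P3) L1 | i <- iota 1 3, j <- iota 1 5]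
  ++ [seq fun t => tcomp 1 L1 (tcomp i t P3) | i <- iota 1 3]
  ++ [seq fun t => tcomp j (tcomp i P3 t) L1 | i <- iota 1 3, j <- iota 1 5]
  ++ [seq fun t => tcomp 1 L1 (tcomp i P3 t) | i <- iota 1 3]
  ++ [seq fun t => tcomp j (tcomp i t L1) P3 | i <- iota 1 3, j <- iota 1 3]
  ++ [seq fun t => tcomp j P3 (tcomp i t L1) | i <- iota 1 3, j <- iota 1 3]
  ++ [seq fun t => tcomp i (tcomp 1 L1 t) P3 | i <- iota 1 3]
  ++ [seq fun t => tcomp i P3 (tcomp 1 L1 t) | i <- iota 1 3].

(** Normal forms make equality of monomials, and hence membership in this list,
decidable by computation. *)
Definition quads : seq quad := [seq map4 (nf \o f) generators | f <- contexts].

Section Linear.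

Variables (K : fieldType) (a b c d : K).

HB.instance Definition _ (M : lmodType K) (f : opmon -> M) :=
  GRing.isZmodMorphism.Build {freeg opmon / K} M (fglift f) (lift_is_additive f).

Definition comb4 (M : lmodType K) (q : M * M * M * M) : M :=
  let: (q0, q1, q2, q3) := q in a *: q0 + b *: q1 + c *: q2 + d *: q3.

Definition dot4 (q : K * K * K * K) : K :=
  let: (q0, q1, q2, q3) := q in a * q0 + b * q1 + c * q2 + d * q3.

Definition lin (q : quad) : oppoly K := comb4 (map4 (@monpoly K) q).

Lemma scale_monpoly k t : k *: monpoly K t = << k *g omon t >>.
Proof. by apply/eqP/freeg_eqP => x; rewrite coeffZ !coeffU mulrA mulr1. Qed.

(** Partial composition with a monomial on either side is the linear extension
of a map on monomials; this is how it is computed on linear combinations. *)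
Lemma fglift_lin (M : lmodType K) (f : opmon -> M) q :
  fglift f (lin q) = comb4 (map4 (fun t => f (omon t)) q).
Proof.
case: q => [[[q0 q1] q2] q3].
by rewrite /lin /= !raddfD /= !scale_monpoly !liftU.
Qed.

Lemma opcomp_linl i q u :
  opcomp i (lin q) (monpoly K u) = lin (map4 (fun t => tcomp i t u) q).
Proof.
have fE (P : oppoly K) :
    opcomp i P (monpoly K u) = fglift (fun x => << mcomp i x (omon u) >>) P.
  rewrite -{2}[P]freeg_sumE raddf_sum; apply: eq_bigr => x _ /=.
  by rewrite domU1 big_seq1 coeffU eqxx !mulr1 liftU.
by rewrite fE fglift_lin; case: q => [[[q0 q1] q2] q3]; rewrite /= !mcomp_omon.
Qed.

Lemma opcomp_linr i u q :
  opcomp i (monpoly K u) (lin q) = lin (map4 (tcomp i u) q).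
Proof.
have fE (P : oppoly K) :
    opcomp i (monpoly K u) P = fglift (fun x => << mcomp i (omon u) x >>) P.
  rewrite -{2}[P]freeg_sumE raddf_sum /opcomp domU1 big_seq1.
  by apply: eq_bigr => x _ /=; rewrite coeffU eqxx !(mul1r, mulr1) liftU.
by rewrite fE fglift_lin; case: q => [[[q0 q1] q2] q3]; rewrite /= !mcomp_omon.
Qed.

Lemma lin_nf q : lin (map4 nf q) = lin q.
Proof. by case: q => [[[q0 q1] q2] q3]; rewrite /lin /monpoly /= !omon_nf. Qed.

Lemma consequencesE : consequences (opR a b c d) = undup (map lin quads).
Proof.
have opRE : opR a b c d = lin generators by [].
rewrite /consequences opRE; apply: (congr1 undup); rewrite /quads -map_comp.
rewrite (eq_map (_ : _ =1 fun f => lin (map4 f generators))); last first.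
  by move=> f; rewrite -[RHS]lin_nf.
rewrite !map_cat.
by repeat congr (_ ++ _); rewrite /= !(opcomp_linl, opcomp_linr).
Qed.

End Linear.

(** * Rank and annihilating functionals *)

Definition quad_in_degree (q : quad) : bool :=
  let: (q0, q1, q2, q3) := q in
  all (fun t => (tdeg t == 5) && (tmult t == 2)) [:: q0; q1; q2; q3].

Lemma quads_in_degree : all quad_in_degree quads.
Proof. by vm_compute. Qed.

Lemma mem_tnth_in (T : eqType) (s : seq T) i : tnth (in_tuple s) i \in s.
Proof. exact: mem_tnth. Qed.

Lemma in_tnthP (T : eqType) (s : seq T) x :
  x \in s -> exists i, x = tnth (in_tuple s) i.
Proof. by move=> /(tnthP (in_tuple s)). Qed.

(** The number of columns minus the rank is the dimension of the space of functions
on ms that vanish on every element of us; it is bounded here from both sides. *)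
Section CoefficientMatrix.

Variables (K : fieldType) (T U : eqType) (ms : seq T) (us : seq U).
Variable coef : T -> U -> K.

Let A : 'M[K]_(size us, size ms) :=
  \matrix_(i, j) coef (tnth (in_tuple ms) j) (tnth (in_tuple us) i).

Definition vanishes_on (phi : T -> K) : Prop :=
  forall u, u \in us -> \sum_(x <- ms) coef x u * phi x = 0.

Let values (phi : T -> K) : 'cV[K]_(size ms) := \col_j phi (tnth (in_tuple ms) j).

Let mulmx_values phi i : (A *m values phi) i 0 =
  \sum_(x <- ms) coef x (tnth (in_tuple us) i) * phi x.
Proof. by rewrite mxE [RHS]big_tnth; apply: eq_bigr => j _; rewrite !mxE. Qed.

(** The functionals form the columns of a matrix of rank n that the coefficient
matrix kills. *)
Lemma rank_vanishes_le n (phi : 'I_n -> T -> K) :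
  (forall k, vanishes_on (phi k)) ->
  (forall lam : 'I_n -> K,
     (forall x, x \in ms -> \sum_k lam k * phi k x = 0) -> forall k, lam k = 0) ->
  (\rank A + n <= size ms)%N.
Proof.
move=> phi0 free.
pose F : 'M[K]_(size ms, n) := \matrix_(j, k) phi k (tnth (in_tuple ms) j).
have AF : A *m F = 0.
  apply/matrixP => i k; rewrite mxE [RHS]mxE; apply: etrans (phi0 k _ (mem_tnth_in i)).
  by rewrite -mulmx_values mxE; apply: eq_bigr => j _; rewrite !mxE.
have : row_free F^T.
  apply: inj_row_free => v vF; apply/matrixP => i k; rewrite ord1 mxE.
  apply: (free (v 0)) => x /in_tnthP[j ->].
  have := congr1 (fun B : 'rV_ _ => B 0 j) vF; rewrite !mxE; apply: etrans.
  by apply: eq_bigr => l _; rewrite !mxE.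
rewrite /row_free mxrank_tr => /eqP rF.
by have := mulmx0_rank_max AF; rewrite rF.
Qed.

(** Adding to the coefficient matrix one row for the evaluation at each element
of s makes its columns independent. *)
Lemma rank_vanishes_ge (s : seq T) : uniq ms ->
  (forall phi, vanishes_on phi -> {in s, forall x, phi x = 0} ->
     {in ms, forall x, phi x = 0}) ->
  (size ms <= \rank A + size s)%N.
Proof.
move=> ums det.
pose E : 'M[K]_(size s, size ms) :=
  \matrix_(k, j) (tnth (in_tuple ms) j == tnth (in_tuple s) k)%:R.
have : row_free (col_mx A E)^T.
  apply: inj_row_free => v vAE.
  pose phi x := \sum_j (tnth (in_tuple ms) j == x)%:R * v 0 j.
  have phiE j : phi (tnth (in_tuple ms) j) = v 0 j.
    rewrite /phi (bigD1 j) //= eqxx mul1r big1 ?addr0 // => l nlj.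
    have x0 := tnth (in_tuple ms) j.
    by rewrite !(tnth_nth x0) nth_uniq // val_eqE (negPf nlj) mul0r.
  have [Av Ev] : A *m v^T = 0 /\ E *m v^T = 0.
    apply: eq_col_mx; rewrite -mul_col_mx col_mx0 -[_ *m _]trmxK.
    by rewrite trmx_mul trmxK vAE trmx0.
  have vE : values phi = v^T by apply/matrixP => j k; rewrite !mxE ord1.
  apply/matrixP => k j; rewrite ord1 mxE -phiE.
  apply: det (mem_tnth_in j).
    by move=> u /in_tnthP[i ->]; rewrite -mulmx_values vE Av mxE.
  move=> x /in_tnthP[i ->].
  have := congr1 (fun B : 'cV_ _ => B i 0) Ev; rewrite !mxE; apply: etrans.
  by apply: eq_bigr => l _; rewrite !mxE.
rewrite /row_free mxrank_tr => /eqP rAE; rewrite -[leqLHS]rAE -addsmxE.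
rewrite (leq_trans (mxrank_adds_leqif _ _)) // leq_add2l.
exact: rank_leq_row.
Qed.

End CoefficientMatrix.

Section Annihilators.

Variables (K : fieldType) (a b c d : K).

Definition annihilates (phi : opmon -> K) : Prop :=
  forall q, q \in quads -> dot4 a b c d (map4 (fun t => phi (omon t)) q) = 0.

Lemma annihilatesP phi : annihilates phi <->
  vanishes_on (monomials 5 2) (consequences (opR a b c d)) (fun x S => coeff x S) phi.
Proof.
have pairM k t : (tdeg t == 5) && (tmult t == 2) ->
    \sum_(x <- monomials 5 2) coeff x (k *: monpoly K t) * phi x = k * phi (omon t).
  move=> /andP[/eqP dt /eqP mt].
  have tM : omon t \in monomials 5 2 by apply/mem_monomials; exists t.
  have uM : uniq (monomials 5 2) by apply: undup_uniq.
  move: (monomials 5 2) tM uM => ms tM uM.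
  rewrite (bigD1_seq (omon t)) //= scale_monpoly coeffU eqxx mulr1.
  rewrite big1 ?addr0 // => x nx.
  by rewrite coeffU eq_sym (negPf nx) mulr0 mul0r.
have pair_lin q : q \in quads ->
    \sum_(x <- monomials 5 2) coeff x (lin a b c d q) * phi x
    = dot4 a b c d (map4 (fun t => phi (omon t)) q).
  move=> /(allP quads_in_degree); case: q => [[[q0 q1] q2] q3] /=.
  move=> /and5P[h0 h1 h2 h3 _]; rewrite -!pairM // -!big_split /=.
  by apply: eq_bigr => x _; rewrite !coeffD !mulrDl.
rewrite /vanishes_on consequencesE; split=> [kill S | van q qs].
  by rewrite mem_undup => /mapP[q qs ->]; rewrite pair_lin // kill.
by rewrite -pair_lin // van // mem_undup map_f.
Qed.

Lemma rank_conseq_le n (phi : 'I_n -> opmon -> K) :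
  (forall k, annihilates (phi k)) ->
  (forall lam : 'I_n -> K,
     (forall x, x \in monomials 5 2 -> \sum_k lam k * phi k x = 0) ->
     forall k, lam k = 0) ->
  (\rank (conseq_matrix 1 (opR a b c d)) + n <= size (monomials 5 2))%N.
Proof.
by move=> kill free; apply: (rank_vanishes_le _ free) => k; apply/annihilatesP.
Qed.

Lemma rank_conseq_ge (s : seq term) :
  (forall phi, annihilates phi -> (forall t, t \in s -> phi (omon t) = 0) ->
     forall t, tdeg t = 5 -> tmult t = 2 -> phi (omon t) = 0) ->
  (size (monomials 5 2) <= \rank (conseq_matrix 1 (opR a b c d)) + size s)%N.
Proof.
move=> det; rewrite -(size_map omon s).
apply: rank_vanishes_ge => [|phi /annihilatesP kill phi_s x]; first exact: undup_uniq.
move=> /mem_monomials[t [-> dt mt]]; apply: det => // u us.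
by apply: phi_s; apply: map_f.
Qed.

End Annihilators.

(** * Blocks and the six relations *)

(** The pair (o, n) is the block of n arguments that follows the first o ones. *)
Definition block := (nat * nat)%type.

(** The blocks covered by the occurrences of L in a term whose first argument
has o arguments to its left. *)
Fixpoint blocks (o : nat) (t : term) : seq block :=
  match t with
  | Arg => [::]
  | Op t1 t2 t3 =>
      blocks o t1 ++ blocks (o + tdeg t1) t2 ++ blocks (o + (tdeg t1 + tdeg t2)) t3
  | Lop u => (o, tdeg u) :: blocks o u
  end.

Lemma assoc_eq_blocks t u : assoc_eq t u -> forall o, blocks o t = blocks o u.
Proof.
elim=> {t u} /=.
- by [].
- by move=> t u _ IH o; rewrite IH.
- by move=> t u v _ IH _ IH' o; rewrite IH IH'.
- move=> t1 t2 t3 u1 u2 u3 e1 IH1 e2 IH2 e3 IH3 o.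
  by rewrite IH1 IH2 IH3 (assoc_eq_tdeg e1) (assoc_eq_tdeg e2).
- by move=> t u e IH o; rewrite IH (assoc_eq_tdeg e).
- by move=> t1 t2 t3 t4 t5 o; rewrite -!catA !addnA.
- by move=> t1 t2 t3 t4 t5 o; rewrite -!catA !addnA.
Qed.

(** The four blocks that L covers in the terms of R when its arguments are
products of n1, n2 and n3 arguments, the first of them in position o. *)
Definition relation (o n1 n2 n3 : nat) : block * block * block * block :=
  ((o, n1 + n2 + n3), (o, n1), (o + n1, n2), (o + n1 + n2, n3))%N.

Definition relations : seq (block * block * block * block) :=
  [:: relation 0 1 1 1; relation 1 1 1 1; relation 2 1 1 1;
      relation 0 3 1 1; relation 0 1 3 1; relation 0 1 1 3].

Definition short_blocks : seq block := [seq (o, 1) | o <- iota 0 5].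

(** The blocks X_0, ..., X_4, Z: around each of them, L can be inserted in every
monomial of degree 5, and this is what makes the products of two of them
symmetric. *)
Definition frame : seq block := rcons short_blocks (0, 5).

Definition all_blocks : seq block := frame ++ [seq (o, 3) | o <- iota 0 3].

(** In each composition defining a consequence, p turns R into one of the six
relations and L contributes the block that multiplies it. *)
Lemma quads_blocks :
  all (fun q => has (fun s => has (fun r =>
    let: (q0, q1, q2, q3) := q in let: (r0, r1, r2, r3) := r in
    [&& perm_eq (blocks 0 q0) [:: s; r0], perm_eq (blocks 0 q1) [:: s; r1],
        perm_eq (blocks 0 q2) [:: s; r2] & perm_eq (blocks 0 q3) [:: s; r3]])
    relations) all_blocks) quads.
Proof. by vm_compute. Qed.

Definition word (n : nat) : term := comb (nseq n Arg).

(** The monomial of degree 5 in which L covers the block s: when the n arguments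
of the block are replaced by one, 6 - n arguments remain. *)
Definition node (s : block) : term := tcomp s.1.+1 (word (6 - s.2)) (Lop (word s.2)).

(** The product of the monomial t with the block s, for s in frame: L is applied
to one argument of t or to t itself. *)
Definition enclose (s : block) (t : term) : term :=
  if s.2 == 1%N then tcomp s.1.+1 t L1 else Lop t.

(** Multiplying by a block of frame means composing with L on one side, which
turns R o_i p and p o_i R into consequences. *)
Lemma enclose_relations : {in frame & relations, forall s r,
  map4 (fun x => nf (enclose s (node x))) r \in quads}.
Proof. by apply/allrelP; vm_compute. Qed.

Lemma enclose_sym : {in frame &, forall s r,
  omon (enclose s (node r)) = omon (enclose r (node s))}.
Proof.
move=> s r sF rF; apply: nf_omon; apply/eqP; move: s r sF rF.
by apply/allrelP; vm_compute.
Qed.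

Section Solutions.

Variables (K : fieldType) (a b c d : K).

Definition solves (g : block -> K) : Prop :=
  {in relations, forall r, dot4 a b c d (map4 g r) = 0}.

(** The representative of the class does not matter, by weight_omon. *)
Definition weight (g : block -> K) (x : opmon) : K := \prod_(s <- blocks 0 (repr x)) g s.

Lemma weight_omon g t : weight g (omon t) = \prod_(s <- blocks 0 t) g s.
Proof.
rewrite /weight (_ : blocks 0 _ = blocks 0 t) //; apply: assoc_eq_blocks.
by apply/assoc_eqP/eqmodP; rewrite reprK.
Qed.

(** On a consequence, the product of the values of g factors as the value at a
block times the value of a relation. *)
Lemma weight_annihilates g : solves g -> annihilates a b c d (weight g).
Proof.
move=> sol q /(allP quads_blocks)/hasP[s _ /hasP[r /sol]].
case: q r => [[[q0 q1] q2] q3] [[[r0 r1] r2] r3] /= rel /and4P[h0 h1 h2 h3].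
rewrite !weight_omon (perm_big _ h0) (perm_big _ h1) (perm_big _ h2) (perm_big _ h3).
rewrite !big_cons big_nil /= !mulr1 !(mulrCA _ (g s)) -!mulrDr.
by rewrite rel mulr0.
Qed.

Definition determines (J : seq block) : Prop :=
  forall g, solves g -> {in J, forall s, g s = 0} -> {in all_blocks, forall s, g s = 0}.

End Solutions.

(** * Monomials of degree 5 and multiplicity 2 *)

Lemma tmult0_word t : tmult t = 0 -> assoc_eq t (word (tdeg t)).
Proof.
move=> mt; apply: assoc_trans (assoc_eq_nf t) _.
rewrite /nf (_ : factors t = nseq (tdeg t) Arg); first exact: assoc_refl.
elim: t mt => //= t1 IH1 t2 IH2 t3 IH3 mt.
rewrite IH1 ?IH2 ?IH3; try lia.
by rewrite -!nseqD addnA.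
Qed.

Lemma odd_tdeg t : odd (tdeg t).
Proof. by elim: t => //= t1 h1 t2 h2 t3 h3; rewrite !oddD h1 h2 h3. Qed.

(** An innermost occurrence of L is applied to a product of arguments; replacing
it by a single argument decreases the multiplicity.  Monomials are listed in
this way because it produces far fewer terms than all bracketings would. *)
Lemma insertion m t : tmult t = m.+1 -> exists i s n,
  [/\ assoc_eq t (tcomp i s (Lop (word n))), (0 < i <= tdeg s)%N, odd n,
      (tdeg s + n = (tdeg t).+1)%N & tmult s = m].
Proof.
elim: t m => //= [t1 IH1 t2 IH2 t3 IH3|t IH] m mt.
- have := (tdeg_gt0 t1, tdeg_gt0 t2, tdeg_gt0 t3) => -[[p1 p2] p3].
  have [/eqP m1|m1] := boolP (tmult t1 == 0%N); last first.
    have [|i [s [n [e Hi on ds ms]]]] := IH1 (tmult t1).-1; first by lia.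
    exists i, (Op s t2 t3), n; split=> //=; try lia.
    have -> : (i <= tdeg s)%N by lia.
    by apply: assoc_Op => //; exact: assoc_refl.
  have [/eqP m2|m2] := boolP (tmult t2 == 0%N); last first.
    have [|i [s [n [e Hi on ds ms]]]] := IH2 (tmult t2).-1; first by lia.
    exists (tdeg t1 + i)%N, (Op t1 s t3), n; split=> //=; try lia.
    have -> : (tdeg t1 + i <= tdeg t1)%N = false by lia.
    have -> : (tdeg t1 + i <= tdeg t1 + tdeg s)%N by lia.
    by rewrite addKn; apply: assoc_Op => //; exact: assoc_refl.
  have [|i [s [n [e Hi on ds ms]]]] := IH3 (tmult t3).-1; first by lia.
  exists (tdeg t1 + tdeg t2 + i)%N, (Op t1 t2 s), n; split=> //=; try lia.
  have -> : (tdeg t1 + tdeg t2 + i <= tdeg t1)%N = false by lia.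
  have -> : (tdeg t1 + tdeg t2 + i <= tdeg t1 + tdeg t2)%N = false by lia.
  by rewrite addKn; apply: assoc_Op => //; exact: assoc_refl.
- have [/eqP m0|m0] := boolP (tmult t == 0%N).
    exists 1%N, Arg, (tdeg t); split=> //=; rewrite ?odd_tdeg //; try lia.
    by apply: assoc_Lop; apply: tmult0_word.
  have [|i [s [n [e Hi on ds ms]]]] := IH (tmult t).-1; first by lia.
  exists i, (Lop s), n; split=> //=; try lia.
  exact: assoc_Lop.
Qed.

(** The monomials in which L(L(xyz)) occurs: the only ones that are not the
product of a block with an element of frame. *)
Definition doubled (o : nat) : term := tcomp o.+1 P3 (Lop (Lop P3)).

Lemma insertions_table :
  (all (fun k => all (fun n' => all (fun n => all (fun j => all (fun i =>
    [&& k + n' + n == 7, j <= k & i < k + n'] ==>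
    (nf (tcomp i (tcomp j (word k) (Lop (word n'))) (Lop (word n)))
      \in [seq nf (enclose s (node r)) | s <- frame, r <- all_blocks]
          ++ [seq nf (doubled o) | o <- iota 0 3]))
  (iota 1 5)) (iota 1 5)) [:: 1; 3; 5]) [:: 1; 3; 5]) [:: 1; 3; 5])%N.
Proof. by vm_compute. Qed.

Lemma monomial_cases t : tdeg t = 5 -> tmult t = 2 ->
  (exists s r, [/\ s \in frame, r \in all_blocks & omon t = omon (enclose s (node r))])
  \/ (exists2 o, o \in iota 0 3 & omon t = omon (doubled o)).
Proof.
move=> dt mt.
have [i [s [n [ets Hi on ds ms]]]] := insertion mt.
have [j [u [n' [esu Hj on' du mu]]]] := insertion ms.
have euw := tmult0_word mu.
have ou := odd_tdeg u.
have : nf t = nf (tcomp i (tcomp j (word (tdeg u)) (Lop (word n'))) (Lop (word n))).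
  apply/eqP/assoc_eqP; apply: assoc_trans ets _; apply: tcomp_assocl.
  by apply: assoc_trans esu _; apply: tcomp_assocl.
move: (tdeg u) (tdeg s) ou Hi ds Hj du dt => k l ok Hi ds Hj du dt.
have oddP m : odd m -> (m <= 5)%N -> m \in [:: 1; 3; 5]%N by case: m => [|[|[|[|[|[|m]]]]]].
have tab : nf (tcomp i (tcomp j (word k) (Lop (word n'))) (Lop (word n)))
      \in [seq nf (enclose s (node r)) | s <- frame, r <- all_blocks]
          ++ [seq nf (doubled o) | o <- iota 0 3].
  have kO : k \in [:: 1; 3; 5]%N by apply: oddP => //; lia.
  have n'O : n' \in [:: 1; 3; 5]%N by apply: oddP => //; lia.
  have nO : n \in [:: 1; 3; 5]%N by apply: oddP => //; lia.
  have jI : j \in iota 1 5 by rewrite mem_iota; lia.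
  have iI : i \in iota 1 5 by rewrite mem_iota; lia.
  have := allP (allP (allP (allP (allP insertions_table k kO) n' n'O) n nO) j jI) i iI.
  by move=> /implyP; apply; lia.
move=> e; move: tab; rewrite -e mem_cat => /orP[] tab; [left | right].
  have /allpairsP[[s' r] /= [sF rA /nf_omon ->]] := tab.
  by exists s', r.
have /mapP[o oI /nf_omon ->] := tab.
by exists o.
Qed.

(** The monomial doubled o occurs in a consequence with coefficient a, and in
another one with coefficient b, c or d according to o, where all other monomials
contain a block of frame. *)
Lemma doubled_quads :
  all (fun o => [&&
    (nf (doubled o), nf (enclose (o, 1) (node (o, 3))),
     nf (enclose (o.+1, 1) (node (o, 3))), nf (enclose (o.+2, 1) (node (o, 3))))
      \in quads
  & let x k s := if o == k then nf (doubled o) else nf (enclose s (node (o, 3))) in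
    (nf (enclose (0, 5) (node (o, 3))), x 0 (0, 1),
     x 1 (if o == 0 then (3, 1) else (1, 1)), x 2 (4, 1)) \in quads])%N
  (iota 0 3).
Proof. by vm_compute. Qed.

(** * Determining sets and the lower bound for the rank *)

Section LowerBound.

Variables (K : fieldType) (a b c d : K).
Hypothesis regular : a != 0 \/ [/\ b != 0, c != 0 & d != 0].

(** The values of phi at the products of two blocks form a symmetric array each
of whose rows solves the relations.  If it vanishes on the pairs of chosen
blocks, then the rows of these blocks are zero, hence, by symmetry, every row
vanishes at the chosen blocks and is zero as well. *)
Lemma determines_rank s1 s2 s3 :
  {subset [:: s1; s2; s3] <= frame} -> determines a b c d [:: s1; s2; s3] ->
  (size (monomials 5 2) <= \rank (conseq_matrix 1 (opR a b c d)) + 6)%N.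
Proof.
move=> JF det.
pose J := [:: s1; s2; s3].
pose pairs := [:: (s1, s1); (s1, s2); (s1, s3); (s2, s2); (s2, s3); (s3, s3)].
apply: (rank_conseq_ge (s := [seq enclose p.1 (node p.2) | p <- pairs])).
move=> phi kill phiJ.
pose g s r := phi (omon (enclose s (node r))).
have gsol s : s \in frame -> solves a b c d (g s).
  move=> sF r rR; rewrite -(kill _ (enclose_relations sF rR)).
  by case: r rR => [[[r0 r1] r2] r3] rR; rewrite /= !omon_nf.
have gC s r : s \in frame -> r \in frame -> g s r = g r s.
  by move=> sF rF; rewrite /g enclose_sym.
have gJJ : {in J &, forall s r, g s r = 0}.
  move=> s r sJ rJ.
  have /orP[pP | pP] : ((s, r) \in pairs) || ((r, s) \in pairs).
  - by move: s r sJ rJ; apply/allrelP; rewrite /allrel /= !inE !eqxx !orbT.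
  - by apply: phiJ; apply/mapP; exists (s, r).
  - by rewrite gC ?JF //; apply: phiJ; apply/mapP; exists (r, s).
have frameS s : s \in frame -> s \in all_blocks by move=> sF; rewrite mem_cat sF.
have g0 : {in frame & all_blocks, forall s r, g s r = 0}.
  move=> s r sF; apply: (det _ (gsol s sF)) => {}r rJ.
  rewrite (gC s r sF (JF r rJ)); apply: (det _ (gsol r (JF r rJ))); last exact: frameS.
  by move=> s' s'J; apply: gJJ.
move=> t dt mt; have [[s [r [sF rA ->]]]|[o oI ->]] := monomial_cases dt mt.
  exact: g0.
have /andP[qa qbcd] := allP doubled_quads o oI.
have gnf s : s \in frame -> phi (omon (nf (enclose s (node (o, 3))))) = 0.
  by move=> sF; rewrite omon_nf; apply: g0 => //; move: o oI {qa qbcd}; apply/allP.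
have [an0|[bn0 cn0 dn0]] := regular.
  move: (kill _ qa); rewrite /= !gnf; try by move: o oI {qa qbcd gnf}; apply/allP.
  by rewrite !mulr0 !addr0 omon_nf => /eqP; rewrite mulf_eq0 (negPf an0) => /eqP.
move: oI (kill _ qbcd); rewrite !inE => /or3P[] /eqP oE; subst o; rewrite /= !gnf //.
all: by rewrite !mulr0 ?addr0 ?add0r omon_nf => /eqP;
  rewrite mulf_eq0 ?(negPf bn0) ?(negPf cn0) ?(negPf dn0) => /eqP.
Qed.

End LowerBound.

(** * Solving the six relations *)

Section DeterminingSets.

Variables (K : fieldType) (a b c d : K).

Lemma solvesP g : solves a b c d g <->
  [/\ a * g (0, 3)%N + b * g (0, 1)%N + c * g (1, 1)%N + d * g (2, 1)%N = 0,
      a * g (1, 3)%N + b * g (1, 1)%N + c * g (2, 1)%N + d * g (3, 1)%N = 0 &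
      a * g (2, 3)%N + b * g (2, 1)%N + c * g (3, 1)%N + d * g (4, 1)%N = 0]
  /\
  [/\ a * g (0, 5)%N + b * g (0, 3)%N + c * g (3, 1)%N + d * g (4, 1)%N = 0,
      a * g (0, 5)%N + b * g (0, 1)%N + c * g (1, 3)%N + d * g (4, 1)%N = 0 &
      a * g (0, 5)%N + b * g (0, 1)%N + c * g (1, 1)%N + d * g (2, 3)%N = 0].
Proof.
split=> [sol|[[e1 e2 e3] [e4 e5 e6]] r].
  split; split; first [exact: (sol (relation 0 1 1 1)) | exact: (sol (relation 1 1 1 1))
    | exact: (sol (relation 2 1 1 1)) | exact: (sol (relation 0 3 1 1))
    | exact: (sol (relation 0 1 3 1)) | exact: (sol (relation 0 1 1 3))].
by rewrite !inE => /orP[/eqP->|/orP[/eqP->|/orP[/eqP->|/orP[/eqP->|/orP[]/eqP->]]]].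
Qed.

(** The values of a ^+ 2 * g Z given by the last three relations agree after
the elimination of the Y_i; these are the two differences. *)
Lemma solves_eliminated g : solves a b c d g ->
  b * (a + b) * g (0, 1)%N + (b * d - c ^+ 2) * g (2, 1)%N = c * (a + d) * g (3, 1)%N
  /\
  c * (a + b) * g (1, 1)%N = (b * d - c ^+ 2) * g (2, 1)%N + d * (a + d) * g (4, 1)%N.
Proof.
case/solvesP=> -[e1 e2 e3] [e4 e5 e6]; split; apply/eqP; rewrite -subr_eq0; apply/eqP.
  (* Each 0 is replaced, from left to right, by the left-hand side of a relation. *)
  transitivity (b * 0 - c * 0 - a * 0 + a * 0 : K); last by ring.
  by rewrite -{1}e1 -{1}e2 -{1}e4 -e5; ring.
transitivity (c * 0 - d * 0 - a * 0 + a * 0 : K); last by ring.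
by rewrite -{1}e2 -{1}e3 -{1}e5 -e6; ring.
Qed.

(** Since a is nonzero, the X_i give the Y_i and then Z. *)
Lemma short_determines : a != 0 -> determines a b c d short_blocks.
Proof.
move=> an0 g /solvesP[[e1 e2 e3] [e4 _ _]] g0.
have x0 o : (o < 5)%N -> g (o, 1%N) = 0.
  by move=> o5; apply: g0; apply/mapP; exists o; rewrite ?mem_iota.
have y0 y : a * y = 0 -> y = 0 by move/eqP; rewrite mulf_eq0 (negPf an0) => /eqP.
rewrite !x0 // !mulr0 !addr0 in e1 e2 e3 e4.
rewrite (y0 _ e1) mulr0 addr0 in e4.
suff /allP g0' : all (fun s => g s == 0) all_blocks by move=> s /g0'/eqP.
by rewrite /= !x0 // (y0 _ e1) (y0 _ e2) (y0 _ e3) (y0 _ e4) eqxx.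
Qed.

(** With a = 0 the relations are triangular: the first three give X_2, X_3, X_4
in turn, and the others give the Y_i. *)
Lemma determines_first_last : a = 0 -> b != 0 -> c != 0 -> d != 0 ->
  determines a b c d [:: (0, 1); (1, 1); (0, 5)]%N.
Proof.
move=> a0 bn0 cn0 dn0 g /solvesP[[e1 e2 e3] [e4 e5 e6]] g0.
have zero (u y : K) : u != 0 -> u * y = 0 -> y = 0.
  by move=> un0 /eqP; rewrite mulf_eq0 (negPf un0) => /eqP.
have x0 : g (0, 1)%N = 0 by apply: g0.
have x1 : g (1, 1)%N = 0 by apply: g0.
have z : g (0, 5)%N = 0 by apply: g0.
rewrite a0 x0 x1 z !(mul0r, mulr0, add0r, addr0) in e1 e2 e3 e4 e5 e6.
have x2 := zero _ _ dn0 e1; rewrite x2 !(mulr0, add0r) in e2 e3.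
have x3 := zero _ _ dn0 e2; rewrite x3 !(mulr0, add0r, addr0) in e3 e4.
have x4 := zero _ _ dn0 e3; rewrite x4 !(mulr0, add0r, addr0) in e4 e5.
have y0 := zero _ _ bn0 e4; have y1 := zero _ _ cn0 e5; have y2 := zero _ _ dn0 e6.
suff /allP g0' : all (fun s => g s == 0) all_blocks by move=> s /g0'/eqP.
by rewrite /= x0 x1 x2 x3 x4 y0 y1 y2 z eqxx.
Qed.

(** The chosen three X_i are those that remain when a pair of pivots is removed
from the two eliminated equations; the pivots depend on which coefficients
vanish.  When a + b or a + d is zero, b * d - c ^+ 2 may be needed as a pivot;
it is nonzero as soon as exactly one of c and b * d is. *)
Lemma exists_determining : a != 0 ->
  ~ (b = 0 /\ c = 0) -> ~ (c = 0 /\ d = 0) -> ~ (b = - a /\ d = - a) ->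
  exists s1 s2 s3,
    {subset [:: s1; s2; s3] <= frame} /\ determines a b c d [:: s1; s2; s3].
Proof.
move=> an0 nbc ncd nab.
have reduce o1 o2 o3 :
    all (fun o => o < 5)%N [:: o1; o2; o3] ->
    (forall g, solves a b c d g ->
       g (o1, 1%N) = 0 -> g (o2, 1%N) = 0 -> g (o3, 1%N) = 0 ->
       {in short_blocks, forall s, g s = 0}) ->
    exists s1 s2 s3,
      {subset [:: s1; s2; s3] <= frame} /\ determines a b c d [:: s1; s2; s3].
  move=> /and4P[l1 l2 l3 _] short; exists (o1, 1%N), (o2, 1%N), (o3, 1%N).
  split=> [|g sol g0].
    have oF o : (o < 5)%N -> (o, 1%N) \in frame by case: o => [|[|[|[|[|o]]]]].
    by apply/allP; rewrite /= !oF.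
  apply: short_determines => //.
  by apply: short; rewrite ?g0 ?inE ?eqxx ?orbT.
have zero (u y : K) : u != 0 -> u * y = 0 -> y = 0.
  by move=> un0 /eqP; rewrite mulf_eq0 (negPf un0) => /eqP.
have zero' (u y : K) : u != 0 -> 0 = u * y -> y = 0 by move=> un0 /esym; apply: zero.
have shortP g : g (0, 1)%N = 0 -> g (1, 1)%N = 0 -> g (2, 1)%N = 0 ->
    g (3, 1)%N = 0 -> g (4, 1)%N = 0 -> {in short_blocks, forall s, g s = 0 :> K}.
  move=> x0 x1 x2 x3 x4.
  suff /allP g0 : all (fun s => g s == 0) short_blocks by move=> s /g0/eqP.
  by rewrite /= x0 x1 x2 x3 x4 eqxx.
have [ab|nab0] := eqVneq (a + b) 0; have [ad|nad0] := eqVneq (a + d) 0.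
- by case: nab; split; apply/eqP; rewrite -addr_eq0 addrC ?ab ?ad.
- have bn0 : b != 0.
    by apply: contra_neq an0 => b0; rewrite -ab b0 addr0.
  have [c0|cn0] := eqVneq c 0.
    have dn0 : d != 0 by apply/eqP => d0; apply: ncd.
    apply: (reduce 0 1 3)%N => // g /solves_eliminated[D1 D2] x0 x1 x3.
    have x2 : g (2, 1)%N = 0.
      apply: (zero (b * d)); first by rewrite mulf_neq0.
      by move: D1; rewrite c0 x0 x3 expr0n subr0 !mulr0 add0r.
    have x4 : g (4, 1)%N = 0.
      apply: (zero' (d * (a + d))); first by rewrite mulf_neq0.
      by move: D2; rewrite x1 x2 !mulr0 add0r.
    exact: shortP.
  have [d0|dn0] := eqVneq d 0.
    apply: (reduce 0 1 4)%N => // g /solves_eliminated[D1 D2] x0 x1 x4.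
    have x2 : g (2, 1)%N = 0.
      apply: (zero' (- c ^+ 2)); first by rewrite oppr_eq0 expf_neq0.
      by move: D2; rewrite x1 x4 d0 !mulr0 sub0r addr0.
    have x3 : g (3, 1)%N = 0.
      apply: (zero' (c * (a + d))); first by rewrite mulf_neq0.
      by move: D1; rewrite x0 x2 !mulr0 add0r.
    exact: shortP.
  apply: (reduce 0 1 2)%N => // g /solves_eliminated[D1 D2] x0 x1 x2.
  have x3 : g (3, 1)%N = 0.
    apply: (zero' (c * (a + d))); first by rewrite mulf_neq0.
    by move: D1; rewrite x0 x2 !mulr0 add0r.
  have x4 : g (4, 1)%N = 0.
    apply: (zero' (d * (a + d))); first by rewrite mulf_neq0.
    by move: D2; rewrite x1 x2 !mulr0 add0r.
  exact: shortP.
- have dn0 : d != 0.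
    by apply: contra_neq an0 => d0; rewrite -ad d0 addr0.
  have [c0|cn0] := eqVneq c 0.
    have bn0 : b != 0 by apply/eqP => b0; apply: nbc.
    apply: (reduce 1 3 4)%N => // g /solves_eliminated[D1 D2] x1 x3 x4.
    have x2 : g (2, 1)%N = 0.
      apply: (zero' (b * d)); first by rewrite mulf_neq0.
      by move: D2; rewrite c0 x1 x4 expr0n subr0 !mulr0 addr0.
    have x0 : g (0, 1)%N = 0.
      apply: (zero (b * (a + b))); first by rewrite mulf_neq0.
      by move: D1; rewrite x2 x3 !mulr0 addr0.
    exact: shortP.
  have [b0|bn0] := eqVneq b 0.
    apply: (reduce 0 3 4)%N => // g /solves_eliminated[D1 D2] x0 x3 x4.
    have x2 : g (2, 1)%N = 0.
      apply: (zero (- c ^+ 2)); first by rewrite oppr_eq0 expf_neq0.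
      by move: D1; rewrite x0 x3 b0 !(mul0r, mulr0) sub0r add0r.
    have x1 : g (1, 1)%N = 0.
      apply: (zero (c * (a + b))); first by rewrite mulf_neq0.
      by move: D2; rewrite x2 x4 !mulr0 addr0.
    exact: shortP.
  apply: (reduce 2 3 4)%N => // g /solves_eliminated[D1 D2] x2 x3 x4.
  have x0 : g (0, 1)%N = 0.
    apply: (zero (b * (a + b))); first by rewrite mulf_neq0.
    by move: D1; rewrite x2 x3 !mulr0 addr0.
  have x1 : g (1, 1)%N = 0.
    apply: (zero (c * (a + b))); first by rewrite mulf_neq0.
    by move: D2; rewrite x2 x4 !mulr0 addr0.
  exact: shortP.
- have [c0|cn0] := eqVneq c 0.
    have bn0 : b != 0 by apply/eqP => b0; apply: nbc.
    have dn0 : d != 0 by apply/eqP => d0; apply: ncd.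
    apply: (reduce 1 2 3)%N => // g /solves_eliminated[D1 D2] x1 x2 x3.
    have x0 : g (0, 1)%N = 0.
      apply: (zero (b * (a + b))); first by rewrite mulf_neq0.
      by move: D1; rewrite x2 x3 !mulr0 addr0.
    have x4 : g (4, 1)%N = 0.
      apply: (zero' (d * (a + d))); first by rewrite mulf_neq0.
      by move: D2; rewrite x1 x2 !mulr0 add0r.
    exact: shortP.
  apply: (reduce 0 2 4)%N => // g /solves_eliminated[D1 D2] x0 x2 x4.
  have x1 : g (1, 1)%N = 0.
    apply: (zero (c * (a + b))); first by rewrite mulf_neq0.
    by move: D2; rewrite x2 x4 !mulr0 addr0.
  have x3 : g (3, 1)%N = 0.
    apply: (zero' (c * (a + d))); first by rewrite mulf_neq0.
    by move: D1; rewrite x0 x2 !mulr0 add0r.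
  exact: shortP.
Qed.

End DeterminingSets.

(** * The upper bound for the generic rank *)

Section GenericRank.

Variables (K : fieldType) (a b c d : K).
Hypotheses (an0 : a != 0) (cn0 : c != 0) (dn0 : d != 0) (adn0 : a + d != 0).

(** The solution of the relations with prescribed values at X_0, X_1, X_2. *)
Definition solution (p : K * K * K) (s : block) : K :=
  let: (x0, x1, x2) := p in
  let x3 := (b * (a + b) * x0 + (b * d - c ^+ 2) * x2) / (c * (a + d)) in
  let x4 := (c * (a + b) * x1 - (b * d - c ^+ 2) * x2) / (d * (a + d)) in
  let y0 := - (b * x0 + c * x1 + d * x2) / a in
  let y1 := - (b * x1 + c * x2 + d * x3) / a in
  let y2 := - (b * x2 + c * x3 + d * x4) / a in
  let z := - (b * y0 + c * x3 + d * x4) / a in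
  if s.2 == 1%N then [:: x0; x1; x2; x3; x4]`_s.1
  else if s.2 == 3%N then [:: y0; y1; y2]`_s.1 else z.

Lemma solution_solves p : solves a b c d (solution p).
Proof.
case: p => [[x0 x1] x2]; apply/solvesP; split; split; rewrite /solution /=; field.
all: by rewrite ?an0 ?cn0 ?dn0 ?adn0.
Qed.

Lemma rank_conseq_upper :
  (\rank (conseq_matrix 1 (opR a b c d)) + 6 <= size (monomials 5 2))%N.
Proof.
(* A quadratic form in three variables is determined by its values at these
   points, so that the six functionals are independent. *)
pose points : seq (K * K * K) :=
  [:: (1, 0, 0); (0, 1, 0); (0, 0, 1); (1, 1, 0); (1, 0, 1); (0, 1, 1)].
apply: (rank_conseq_le (n := 6)
  (phi := fun k => weight (solution (nth (0, 0, 0) points k)))).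
  by move=> k; apply: weight_annihilates; apply: solution_solves.
move=> lam free.
have at_ i j : (i < 3)%N -> (j < 3)%N -> \sum_k lam k *
    (solution (nth (0, 0, 0) points k) (i, 1%N)
     * solution (nth (0, 0, 0) points k) (j, 1%N)) = 0.
  move=> i3 j3; have mem_ij : omon (enclose (i, 1%N) (node (j, 1%N))) \in monomials 5 2.
    apply/mem_monomials; exists (enclose (i, 1%N) (node (j, 1%N))).
    by split=> //; move: i j i3 j3 {free} => [|[|[|i]]] // [|[|[|j]]].
  apply: etrans (free _ mem_ij); apply: eq_bigr => k _; rewrite weight_omon.
  congr (_ * _); move: i j i3 j3 {free mem_ij} => [|[|[|i]]] // [|[|[|j]]] // _ _;
    by rewrite !big_cons big_nil mulr1 // mulrC.
have simp := (mulr0, mul0r, mulr1, addr0, add0r).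
have l3 := at_ 0%N 1%N isT isT; have l4 := at_ 0%N 2%N isT isT; have l5 := at_ 1%N 2%N isT isT.
have l0 := at_ 0%N 0%N isT isT; have l1 := at_ 1%N 1%N isT isT; have l2 := at_ 2%N 2%N isT isT.
move: l0 l1 l2 l3 l4 l5; rewrite !big_ord_recl !big_ord0 /= /solution /= !simp.
move=> + + + l3 l4 l5; rewrite l3 l4 l5 !simp => l0 l1 l2.
by case=> [[|[|[|[|[|[|k]]]]]] lt_k] //;
  [rewrite -[RHS]l0 | rewrite -[RHS]l1 | rewrite -[RHS]l2
  | rewrite -[RHS]l3 | rewrite -[RHS]l4 | rewrite -[RHS]l5];
  congr lam; apply: val_inj.
Qed.

End GenericRank.

Lemma generic_rank_le (F : fieldType) :
  (\rank (conseq_matrix 1 (generic_opR F)) + 6 <= size (monomials 5 2))%N.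
Proof.
(* An element of the polynomial ring is nonzero as soon as one value is. *)
have indet_eval (p : {mpoly F[4]}) (v : 'I_4 -> F) : p.@[v] != 0 -> tofrac p != 0.
  by rewrite tofrac_eq0; apply: contra_neq => ->; rewrite meval0.
have indetn0 i : indet F i != 0.
  by apply: (indet_eval _ (fun=> 1)); rewrite mevalXU oner_eq0.
apply: rank_conseq_upper => //.
rewrite /indet -tofracD; apply: (indet_eval _ (fun i => (i == 0)%:R)).
by rewrite mevalD !mevalXU /= addr0 oner_eq0.
Qed.

(** * Submaximal rank *)

Lemma submaximal_exceptional (F : fieldType) (a b c d : F) :
  submaximal_rank (opR a b c d) ->
  if a == 0 then [\/ b = 0, c = 0 | d = 0]
  else [\/ b = 0 /\ c = 0, c = 0 /\ d = 0 | b = - a /\ d = - a].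
Proof.
rewrite /submaximal_rank => lt_rank.
have nodet s1 s2 s3 : a != 0 \/ [/\ b != 0, c != 0 & d != 0] ->
    {subset [:: s1; s2; s3] <= frame} -> ~ determines a b c d [:: s1; s2; s3].
  move=> reg JF /(determines_rank reg JF).
  by have := generic_rank_le F; move: lt_rank; clear; lia.
have [a0|an0] := eqVneq a 0.
  have [b0|bn0] := eqVneq b 0; first by constructor 1.
  have [c0|cn0] := eqVneq c 0; first by constructor 2.
  have [d0|dn0] := eqVneq d 0; first by constructor 3.
  case: (@nodet (0, 1) (1, 1) (0, 5))%N; first by right.
    by apply/allP.
  exact: determines_first_last.
have [/andP[/eqP b0 /eqP c0]|nbc] := boolP ((b == 0) && (c == 0)).
  by constructor 1.
have [/andP[/eqP c0 /eqP d0]|ncd] := boolP ((c == 0) && (d == 0)).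
  by constructor 2.
have [/andP[/eqP b0 /eqP d0]|nbd] := boolP ((b == - a) && (d == - a)).
  by constructor 3.
have [|||s1 [s2 [s3 [JF]]]] := @exists_determining _ a b c d an0.
- by case=> b0 c0; rewrite b0 c0 eqxx in nbc.
- by case=> c0 d0; rewrite c0 d0 eqxx in ncd.
- by case=> b0 d0; rewrite b0 d0 eqxx in nbd.
by move=> det; case: (nodet _ _ _ (or_introl an0) JF det).
Qed.

Lemma opR_equivalent (F : fieldType) (k a b c d : F) : k != 0 ->
  equivalent (opR (k * a) (k * b) (k * c) (k * d)) (opR a b c d).
Proof. by move=> kn0; exists k; rewrite // /opR !scalerDr !scalerA. Qed.

Theorem theorem4p1 (a b c d : rat) :
  opR a b c d != 0 ->
  {subset [:: a; b; c; d] <= [:: 0; 1; -1; 2; -2]} ->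
  submaximal_rank (opR a b c d) ->
     (exists d' : rat, equivalent (opR a b c d) (opR 1 0 0 d'))
  \/ (exists b' : rat, equivalent (opR a b c d) (opR 1 b' 0 0))
  \/ (exists c' : rat, equivalent (opR a b c d) (opR 1 (-1) c' (-1)))
  \/ (exists d' : rat, equivalent (opR a b c d) (opR 0 1 0 d'))
  \/ (exists c' : rat, equivalent (opR a b c d) (opR 0 1 c' 0))
  \/ (exists d' : rat, equivalent (opR a b c d) (opR 0 0 1 d'))
  \/ equivalent (opR a b c d) (opR 0 0 0 1).
Proof.
move=> Rn0 _ /submaximal_exceptional.
have normalize k a' b' c' d' : k != 0 -> a = k * a' -> b = k * b' -> c = k * c' ->
    d = k * d' -> equivalent (opR a b c d) (opR a' b' c' d').
  by move=> kn0 -> -> -> ->; apply: opR_equivalent.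
have [a0|an0] := eqVneq a 0; last first.
  case=> [[b0 c0]|[c0 d0]|[ba da]].
  - by left; exists (d / a); apply: (normalize a) => //; rewrite ?mulr0 ?mulr1 // mulrC divfK.
  - right; left; exists (b / a).
    by apply: (normalize a) => //; rewrite ?mulr0 ?mulr1 // mulrC divfK.
  - do 2!right; left; exists (c / a).
    by apply: (normalize a) => //; rewrite ?mulr1 ?mulrN1 // mulrC divfK.
move=> bcd0; do 3!right.
have [b0|bn0] := eqVneq b 0.
  have [c0|cn0] := eqVneq c 0.
    have dn0 : d != 0.
      by apply: contra_neq Rn0 => d0; rewrite a0 b0 c0 d0 /opR !scale0r !addr0.
    by do 3!right; apply: (normalize d); rewrite ?mulr0 ?mulr1.
  do 2!right; left; exists (d / c).
  by apply: (normalize c) => //; rewrite ?mulr0 ?mulr1 // mulrC divfK.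
case: bcd0 => [b0|c0|d0]; first by rewrite b0 eqxx in bn0.
- left; exists (d / b).
  by apply: (normalize b) => //; rewrite ?mulr0 ?mulr1 // mulrC divfK.
- right; left; exists (c / b).
  by apply: (normalize b) => //; rewrite ?mulr0 ?mulr1 // mulrC divfK.
Qed.
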